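(* Let $n_1,n_2\geq3$ and let $\mathcal{G}=\mathcal{P}_1\,\square\,\mathcal{P}_2$ be the regular grid of dimension $n_1\times n_2$, with unit edge weights, i.e. the Cartesian product of the path graphs $\mathcal{P}_1,\mathcal{P}_2$ on $n_1$ and $n_2$ vertices. Let $K$ be the vertex-to-edge incidence map of $\mathcal{G}$. Then the condition number in the unpreconditioned case is bounded by $$\kappa(K)\geq\frac{\sqrt{2}\,\max(n_1,n_2)}{\sqrt{\pi^2/2}} .$$ Moreover, let $\mathcal{E}=\mathcal{E}_1\sqcup\mathcal{E}_2$ be the natural partition of the edge set of $\mathcal{G}$ into two linear forests, where $\mathcal{E}_1$ consists of the edges along the $\mathcal{P}_1$ direction (horizontal chains) and $\mathcal{E}_2$ of the edges along the $\mathcal{P}_2$ direction (vertical chains), and let $T=\sum_{l=1}^2P_l^\top K_lK_l^\top P_l$. Then $$\kappa\bigl(T^{-1/2}K\bigr)=\sqrt{2}.$$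
   Context: The path graph is $\mathcal{P}_l=(\{1,\dots,n_l\},\{(i,i+1)\}_{i=1}^{n_l-1})$. The Cartesian product of two graphs with vertex sets $\mathcal{V}_1,\mathcal{V}_2$ has vertex set $\mathcal{V}_1\times\mathcal{V}_2$, with $(v_1,v_2)$ and $(v_1',v_2')$ adjacent if and only if either $v_1=v_1'$ and $v_2$ is adjacent to $v_2'$, or $v_2=v_2'$ and $v_1$ is adjacent to $v_1'$. Thus, writing $\mathcal{V}=\{1,\dots,n_1\}\times\{1,\dots,n_2\}$ for the vertex set of $\mathcal{G}$, $\mathcal{E}_1$ is the set of edges joining $(i,j)$ and $(i+1,j)$ ($1\le i<n_1$, $1\le j\le n_2$), and $\mathcal{E}_2$ the set of edges joining $(i,j)$ and $(i,j+1)$ ($1\le i\le n_1$, $1\le j<n_2$); each $(\mathcal{V},\mathcal{E}_l)$ is a linear forest (a forest in which every tree is a path). The matrix $K:\mathbb{R}^{\mathcal{V}}\to\mathbb{R}^{\mathcal{E}}$ is $(Ku)_e=u_a-u_b$ for each edge $e=(a,b)$, with an arbitrarily fixed orientation of each edge. $P_l:\mathbb{R}^{\mathcal{E}}\to\mathbb{R}^{\mathcal{E}_l}$ is the restriction $P_lp=p|_{\mathcal{E}_l}$ and $K_l=P_lK$; the matrices $K_lK_l^\top$ are invertible because the subgraphs are forests. For a nonzero real matrix $A$, the (finite) condition number is $\kappa(A)=\sigma_{\max}(A)/\sigma_{\min>0}(A)$, the ratio of the largest to the smallest nonzero singular value. *)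

(* Defs.v *)
From mathcomp Require Import all_boot all_order all_algebra.
From mathcomp Require Import all_classical all_reals all_analysis.

Set Implicit Arguments.
Unset Strict Implicit.
Unset Printing Implicit Defensive.

Import Order.TTheory GRing.Theory Num.Theory.
Local Open Scope ring_scope.
Local Open Scope classical_set_scope.

Section Graphs.

(* The vertices 1, ..., n are numbered from 0. *)
Definition path_graph (n : nat) : rel 'I_n :=
  fun i j => (i.+1 == j :> nat) || (j.+1 == i :> nat).

Definition cartesian_product (V1 V2 : finType) (g1 : rel V1) (g2 : rel V2) :
    rel (V1 * V2)%type :=
  fun v w => ((v.1 == w.1) && g2 v.2 w.2) || ((v.2 == w.2) && g1 v.1 w.1).

Definition grid (n1 n2 : nat) : rel ('I_n1 * 'I_n2)%type :=
  cartesian_product (@path_graph n1) (@path_graph n2).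

(* [E] contains exactly one of (a, b), (b, a) for every edge {a, b} of the
   simple graph [g], and nothing else: it is the edge set of [g] with an
   orientation chosen for each edge. *)
Definition oriented_edge_set (V : finType) (g : rel V)
    (E : {set (V * V)%type}) : Prop :=
  forall a b : V, (g a b = ((a, b) \in E) || ((b, a) \in E)) /\
                  ~~ (((a, b) \in E) && ((b, a) \in E)).

Definition edges1 (n1 n2 : nat)
    (E : {set (('I_n1 * 'I_n2) * ('I_n1 * 'I_n2))%type}) :=
  [set e in E | e.1.2 == e.2.2]%SET.

Definition edges2 (n1 n2 : nat)
    (E : {set (('I_n1 * 'I_n2) * ('I_n1 * 'I_n2))%type}) :=
  [set e in E | e.1.1 == e.2.1]%SET.

End Graphs.

Section Incidence.
Variables (R : pzRingType) (V : finType).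

(* R^V and R^E are identified with column vectors via [enum_val]. *)
Definition incidence (E : {set (V * V)%type}) : 'M[R]_(#|E|, #|V|) :=
  \matrix_(e, v) ((enum_val v == (enum_val e).1)%:R
                  - (enum_val v == (enum_val e).2)%:R).

Definition edge_restriction (E F : {set (V * V)%type}) : 'M[R]_(#|F|, #|E|) :=
  \matrix_(f, e) (enum_val f == enum_val e)%:R.

(* With P the restriction from E to E_l and K_l = P K, this is the summand
   P^T K_l K_l^T P. *)
Definition precond_term (E El : {set (V * V)%type}) : 'M[R]_#|E| :=
  let P := edge_restriction E El in
  let Kl := P *m incidence E in
  P^T *m (Kl *m Kl^T) *m P.

End Incidence.

Definition grid_precond (R : pzRingType) (n1 n2 : nat)
    (E : {set (('I_n1 * 'I_n2) * ('I_n1 * 'I_n2))%type}) : 'M[R]_#|E| :=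
  precond_term R E (edges1 E) + precond_term R E (edges2 E).

Section Matrices.
Variable R : realType.

(* Square roots of the eigenvalues of A^T A.  This may contain 0 where a
   convention with min(m, n) singular values does not; the nonzero singular
   values are the same. *)
Definition singular_values (m n : nat) (A : 'M[R]_(m, n)) : set R :=
  [set Num.sqrt a | a in [set a : R | eigenvalue (A^T *m A) a]].

(* The set of singular values is finite, so for A != 0 the supremum and the
   infimum are a maximum and a minimum. *)
Definition condition_number (m n : nat) (A : 'M[R]_(m, n)) : R :=
  sup (singular_values A) / inf [set s | singular_values A s /\ s != 0].

Definition psdmx (n : nat) (A : 'M[R]_n) : Prop :=
  A^T = A /\ forall x : 'cV[R]_n, 0 <= (x^T *m A *m x) 0 0.

(* The unique positive semidefinite square root of a positive semidefinite
   matrix (and 0 if there is none). *)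
Definition mxsqrt (n : nat) (A : 'M[R]_n) : 'M[R]_n :=
  xget 0 [set S | psdmx S /\ S *m S = A].

Definition mxinvsqrt (n : nat) (A : 'M[R]_n) : 'M[R]_n := mxsqrt (invmx A).

End Matrices.

(* Main.v *)
Require Import Defs.
From mathcomp Require Import all_boot all_order all_algebra.
From mathcomp Require Import all_classical all_reals all_analysis.
From mathcomp Require Import complex.
From mathcomp Require Import ring lra zify.

Set Implicit Arguments.
Unset Strict Implicit.
Unset Printing Implicit Defensive.

Import Order.TTheory GRing.Theory Num.Theory.
Local Open Scope ring_scope.

(** Write L = K^T K for the Laplacian of the grid and lambda_k(n) =
2 - 2 cos(k pi / n) for the eigenvalues of the path on n vertices.

First bound.  Products of cosine modes of the two paths are eigenvectors of L,
with eigenvalue lambda_k(n1) + lambda_l(n2) ([grid_eigenvalue]).  The two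
highest modes give an eigenvalue at least 2 + 2 = 4; the mode that is constant
along the short side and has k = 1 along the side of length N = max(n1, n2)
gives a positive eigenvalue lambda_1(N) <= (pi / N)^2, since |sin x| <= |x|.
Hence kappa(K) >= 2 / (pi / N), which is the stated bound.

Second claim.  Let K_1 and K_2 be the incidence matrices of the two forests.
Cutting a chain at an edge isolates that edge, so the rows of K_l are free and
M_l = K_l K_l^T is invertible ([chain_forest_row_free]).  As the forests
partition the edges, T is block diagonal with blocks M_1 and M_2, and therefore

  (T^(-1/2) K)^T (T^(-1/2) K) = K^T T^(-1) K = Q_1 + Q_2,
  Q_l = K_l^T M_l^(-1) K_l

([preconditioned_gram]).  Q_l is the orthogonal projection with kernel
ker K_l, that is, the functions constant on the chains of direction l; so
Q_l = 1 - A_l, where A_l averages over chains ([chain_projectionE]).  Averaging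
over rows and over columns commute, both orders being the average over the
whole grid; so Q_1 and Q_2 commute, and a sum of two commuting projections has
eigenvalues in {0, 1, 2} ([condition_number_commuting_projections]).  Both 1
and 2 occur, and kappa = sqrt 2 / sqrt 1.

That T^(-1/2) denotes an actual square root rests on the spectral theorem for
real symmetric matrices: such a matrix is annihilated by a product of distinct
real linear factors ([symmetric_annihilator]), and interpolation at the
eigenvalues turns any function of the spectrum into a polynomial in the matrix
([psdmx_sqrt]). *)

(** * Real symmetric matrices and their square roots *)

(** A complex unitary matrix diagonalizes A with real diagonal entries; the
polynomial vanishing at these entries has real coefficients, so it already
annihilates A over the reals. *)
Lemma symmetric_annihilator_seq (R : realType) n (A : 'M[R]_n.+1) : A^T = A ->
  exists2 rs : seq R, uniq rs & horner_mx A (\prod_(r <- rs) ('X - r%:P)) = 0.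
Proof.
move=> symA; pose toC : {rmorphism R -> R[i]} := real_complex R.
pose B := map_mx toC A.
have hermB : B \is hermsymmx.
  apply/is_hermitianmxP; rewrite expr0 scale1r.
  apply/matrixP=> i j; rewrite !mxE -[in LHS]symA mxE.
  by rewrite conj_Creal // complex_real.
have /orthomx_spectralP eqB := hermitian_normalmx hermB.
have /mxOverP realD := hermitian_spectral_diag_real hermB.
set d := spectral_diag B in eqB realD.
set U := spectralmx B in eqB.
have Uunit : U \is a GRing.unit by exact: spectral_unit.
exists (undup [seq complex.Re (d 0 i) | i <- enum 'I_n.+1]); first exact: undup_uniq.
apply: (@map_mx_inj _ _ toC); rewrite map_mx0 map_horner_mx -/B eqB.
rewrite -{2}[U](@invrK _ U) horner_mx_uconj ?unitrV // horner_mx_diag.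
suff -> : map_mx (horner (map_poly toC
    (\prod_(r <- undup [seq complex.Re (d 0 i) | i <- enum 'I_n.+1]) ('X - r%:P)))) d = 0.
  by rewrite linear0 mulmx0 mul0mx.
apply/rowP=> i; rewrite !mxE -[d 0 i](RRe_real (realD 0 i)) horner_map /=.
suff /rootP -> : root (\prod_(r <- undup [seq complex.Re (d 0 i) | i <- enum 'I_n.+1])
    ('X - r%:P)) (complex.Re (d 0 i)) by [].
by rewrite root_prod_XsubC mem_undup; apply/mapP; exists i; rewrite ?mem_enum.
Qed.

(** The minimal polynomial divides a product of distinct linear factors, hence is
itself such a product, and its roots are eigenvalues. *)
Lemma symmetric_annihilator (R : realType) n (A : 'M[R]_n.+1) : A^T = A ->
  exists rs : seq R, [/\ uniq rs, {in rs, forall r, eigenvalue A r}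
    & horner_mx A (\prod_(r <- rs) ('X - r%:P)) = 0].
Proof.
move=> /symmetric_annihilator_seq [rs urs /mxminpoly_min].
case/dvdp_prod_XsubC=> m eqm; exists (mask m rs); split.
- exact: mask_uniq.
- move=> r rin; rewrite eigenvalue_root_min (eqp_root eqm).
  by rewrite root_prod_XsubC.
- by apply/mxminpoly_minP; rewrite (eqp_dvdl _ eqm).
Qed.

Lemma eigenvalue_mem_annihilator (F : fieldType) n (A : 'M[F]_n.+1) rs a :
  horner_mx A (\prod_(r <- rs) ('X - r%:P)) = 0 -> eigenvalue A a -> a \in rs.
Proof.
move=> /mxminpoly_min dvd; rewrite eigenvalue_root_min => ra.
by rewrite -root_prod_XsubC; apply: root_dvdp ra.
Qed.

(** Newton's scheme: a new node is met by adding a multiple of the polynomial that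
vanishes at the previous ones. *)
Lemma interpolation (F : fieldType) (f : F -> F) (rs : seq F) : uniq rs ->
  exists q : {poly F}, {in rs, forall r, q.[r] = f r}.
Proof.
elim: rs => [|r rs IH] /=; first by exists 0.
case/andP=> nr /IH [q hq].
pose w := \prod_(s <- rs) ('X - s%:P).
have wr : w.[r] != 0 by rewrite -/(root w r) root_prod_XsubC.
exists (q + ((f r - q.[r]) / w.[r]) *: w) => s; rewrite inE hornerD hornerZ.
case/predU1P=> [->|sin]; first by rewrite divfK // addrC subrK.
by rewrite (rootP (_ : root w s)) ?root_prod_XsubC // mulr0 addr0 hq.
Qed.

Lemma trmx_horner_mx (R : comNzRingType) n (A : 'M[R]_n.+1) (p : {poly R}) :
  A^T = A -> (horner_mx A p)^T = horner_mx A p.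
Proof.
move=> symA; elim/poly_ind: p => [|p c IH]; first by rewrite rmorph0 trmx0.
rewrite !rmorphD !rmorphM /= horner_mx_X horner_mx_C linearD /= tr_scalar_mx.
rewrite -[_ * A]/(_ *m A) trmx_mul IH symA; congr (_ + _).
exact/comm_mx_horner.
Qed.

Lemma sqr_mx_ge0 (R : realType) n (x : 'cV[R]_n) : 0 <= (x^T *m x) 0 0.
Proof. by rewrite mxE sumr_ge0 // => i _; rewrite !mxE -expr2 sqr_ge0. Qed.

Lemma sqr_mx_eq0 (R : realType) n (x : 'cV[R]_n) : (x^T *m x) 0 0 = 0 -> x = 0.
Proof.
rewrite mxE => /eqP; rewrite psumr_eq0 => [/allP h|i _]; last first.
  by rewrite mxE -expr2 sqr_ge0.
apply/colP=> i; have := h i (mem_index_enum _).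
by rewrite !mxE -expr2 sqrf_eq0 => /eqP.
Qed.

Lemma psdmx_gram (R : realType) m n (B : 'M[R]_(m, n)) : psdmx (B^T *m B).
Proof.
split=> [|x]; first by rewrite trmx_mul trmxK.
by rewrite mulmxA -trmx_mul -mulmxA sqr_mx_ge0.
Qed.

Lemma psdmxD (R : realType) n (A B : 'M[R]_n) :
  psdmx A -> psdmx B -> psdmx (A + B).
Proof.
move=> [sA pA] [sB pB]; split=> [|x]; first by rewrite linearD /= sA sB.
by rewrite mulmxDr mulmxDl mxE addr_ge0.
Qed.

Lemma psdmx_inv (R : realType) n (A : 'M[R]_n) :
  A \in unitmx -> psdmx A -> psdmx (invmx A).
Proof.
move=> uA [sA pA]; have sV : (invmx A)^T = invmx A by rewrite trmx_inv sA.
split=> // x; have := pA (invmx A *m x).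
by rewrite trmx_mul sV -!mulmxA mulKVmx // !mulmxA.
Qed.

Lemma psdmx_eigenvalue_ge0 (R : realType) n (A : 'M[R]_n) a :
  psdmx A -> eigenvalue A a -> 0 <= a.
Proof.
move=> [_ pA] /eigenvalueP [v hv v0]; have := pA v^T.
rewrite trmxK hv -scalemxAl mxE pmulr_lge0 //.
have := sqr_mx_ge0 v^T; rewrite trmxK le_eqVlt => /orP[/eqP h|//].
have /(congr1 trmx) : v^T = 0 by apply: sqr_mx_eq0; rewrite trmxK.
by rewrite trmxK trmx0 => e; rewrite e eqxx in v0.
Qed.

(** The root is q(A)^2, where q interpolates the fourth root at the eigenvalues: its
square q(A)^4 agrees with A because q^4 - X vanishes on the spectrum, and being
the square of a symmetric matrix it is positive semidefinite with no need of an
eigenbasis. *)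
Lemma psdmx_sqrt (R : realType) n (A : 'M[R]_n) :
  psdmx A -> exists S, psdmx S /\ S *m S = A.
Proof.
case: n A => [|n] A psdA.
  by exists A; split; rewrite // [A]thinmx0 mul0mx.
have [symA _] := psdA.
have [rs [urs eigrs annA]] := symmetric_annihilator symA.
have [q hq] := interpolation (fun r => Num.sqrt (Num.sqrt r)) urs.
pose S := horner_mx A (q ^+ 2); exists S; split.
  rewrite /S expr2 rmorphM /= -{1}(trmx_horner_mx q symA); exact: psdmx_gram.
suff: mxminpoly A %| q ^+ 4 - 'X.
  move/mxminpoly_minP; rewrite rmorphB /= horner_mx_X => /eqP.
  by rewrite subr_eq0 (exprM q 2 2) [_ ^+ 2 in X in X -> _]expr2 rmorphM => /eqP.
apply: dvdp_trans (mxminpoly_min annA) _.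
apply: uniq_roots_dvdp; last by rewrite uniq_rootsE.
apply/allP=> r rin; have r0 := psdmx_eigenvalue_ge0 psdA (eigrs r rin).
rewrite rootE !hornerE hq //= (exprM _ 2 2) sqr_sqrtr ?sqrtr_ge0 //.
by rewrite sqr_sqrtr // subrr.
Qed.

(** * Condition numbers from eigenvalues *)

(** This keeps the infimum of the nonzero singular values away from 0. *)
Lemma finite_positive_gap (R : realFieldType) (rs : seq R) :
  exists2 c, 0 < c & {in rs, forall r, 0 < r -> c <= r}.
Proof.
elim: rs => [|r rs [c c0 hc]]; first by exists 1.
have [r0|r0] := ltP 0 r.
  exists (Num.min c r); first by rewrite lt_min c0 r0.
  move=> s; rewrite inE => /predU1P[->|/hc h] s0; rewrite ge_min ?lexx ?orbT //.
  by rewrite h.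
exists c => // s; rewrite inE => /predU1P[->|/hc //].
by rewrite ltNge r0.
Qed.

Lemma finite_upper_bound (R : realFieldType) (rs : seq R) :
  exists C, {in rs, forall r, r <= C}.
Proof.
elim: rs => [|r rs [C hC]]; first by exists 0.
exists (Num.max C r) => s; rewrite inE => /predU1P[->|/hC h].
  by rewrite le_max lexx orbT.
by rewrite le_max h.
Qed.

(** The spectrum is finite, so the supremum is over a bounded set and the infimum
is positive; each is then compared with one of its members. *)
Lemma condition_number_ge (R : realType) m n (A : 'M[R]_(m, n)) a b :
  eigenvalue (A^T *m A) a -> eigenvalue (A^T *m A) b -> 0 < b ->
  Num.sqrt a / Num.sqrt b <= condition_number A.
Proof.
case: n A => [|n] A ea eb b0.
  by case/eigenvalueP: eb => v _; rewrite [v]thinmx0 eqxx.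
have [rs [_ _ ann]] := symmetric_annihilator (psdmx_gram A).1.
have sub s : singular_values A s -> s \in [seq Num.sqrt r | r <- rs].
  case=> r er <-; apply: map_f; exact: eigenvalue_mem_annihilator ann er.
have [C hC] := finite_upper_bound [seq Num.sqrt r | r <- rs].
have [c c0 hc] := finite_positive_gap [seq Num.sqrt r | r <- rs].
have sva r : eigenvalue (A^T *m A) r -> singular_values A (Num.sqrt r).
  by exists r.
set pos := [set s | singular_values A s /\ s != 0]%classic.
have posb : pos (Num.sqrt b) by split; [exact: sva | rewrite sqrtr_eq0 -ltNge].
have lbc : lbound pos c.
  move=> s [hs s0]; apply: hc; first exact: sub.
  by rewrite lt_def s0; case: hs => r _ <-; rewrite sqrtr_ge0.
have infb : inf pos <= Num.sqrt b by apply: ge_inf posb; exists c.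
have inf0 : 0 < inf pos.
  by apply: lt_le_trans c0 _; apply: lb_le_inf => //; exists (Num.sqrt b).
have supa : Num.sqrt a <= sup (singular_values A).
  by apply: ub_le_sup (sva _ ea); exists C => s /sub /hC.
rewrite /condition_number -/pos ler_pM ?sqrtr_ge0 ?invr_ge0 ?sqrtr_ge0 //.
by rewrite lef_pV2 // posrE // sqrtr_gt0.
Qed.

Lemma condition_number_eq (R : realType) m n (A : 'M[R]_(m, n)) a b :
  0 < b -> eigenvalue (A^T *m A) a -> eigenvalue (A^T *m A) b ->
  (forall r, eigenvalue (A^T *m A) r -> r = 0 \/ b <= r <= a) ->
  condition_number A = Num.sqrt a / Num.sqrt b.
Proof.
move=> b0 ea eb hr; apply/eqP; rewrite eq_le (condition_number_ge ea eb b0).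
rewrite andbT /condition_number; set pos := [set s | _]%classic.
have sb0 : 0 < Num.sqrt b by rewrite sqrtr_gt0.
have supa : sup (singular_values A) <= Num.sqrt a.
  apply: ge_sup; first by exists (Num.sqrt a), a.
  by move=> _ [r /hr[->|/andP[_ ra]] <-]; rewrite ?sqrtr0 ?sqrtr_ge0 ?ler_wsqrtr.
have infb : Num.sqrt b <= inf pos.
  apply: lb_le_inf; first by exists (Num.sqrt b); split; [exists b | rewrite gt_eqF].
  move=> _ [[r /hr[->|/andP[br _]] <-]]; first by rewrite sqrtr0 eqxx.
  by rewrite ler_wsqrtr.
apply: (@le_trans _ _ (Num.sqrt a / inf pos)).
  by rewrite ler_wpM2r // invr_ge0; apply: le_trans infb; apply: ltW.
rewrite ler_wpM2l ?sqrtr_ge0 // lef_pV2 //; rewrite posrE //.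
exact: lt_le_trans infb.
Qed.

Lemma eigenvalue_left_mul (F : fieldType) m n (Q : 'M[F]_n) (B : 'M[F]_(m, n)) a :
  B != 0 -> B *m Q = a *: B -> eigenvalue Q a.
Proof.
move=> B0 hB; have /row_subPn[i ri] : ~~ (B <= (0 : 'M[F]_n))%MS by rewrite submx0.
apply/eigenvalueP; exists (row i B); last by move: ri; rewrite submx0.
by rewrite -row_mul hB linearZ.
Qed.

(** Multiplying v (P + Q) = r v on the right by P and by Q gives v P Q =
(r - 1) v P = (r - 1) v Q.  If r is not 1 then v P = v Q = v P Q, and either
this vector is nonzero and r = 2, or it vanishes and r v = 0.  The nonzero rows
of P Q are eigenvectors for 2, and those of P - P Q for 1. *)
Lemma condition_number_commuting_projections (R : realType) m n
    (A : 'M[R]_(m, n)) (P Q : 'M[R]_n) :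
  A^T *m A = P + Q -> P *m P = P -> Q *m Q = Q -> P *m Q = Q *m P ->
  P *m Q != 0 -> P *m Q != P -> condition_number A = Num.sqrt 2.
Proof.
move=> eqA PP QQ PQ PQ0 PQP.
rewrite (@condition_number_eq _ _ _ A 2 1) ?ltr01 ?sqrtr1 ?divr1 // eqA.
- apply: eigenvalue_left_mul PQ0 _.
  by rewrite mulmxDr -(mulmxA P Q Q) QQ PQ -mulmxA PP -PQ scaler_nat.
- apply: (@eigenvalue_left_mul _ _ _ _ (P - P *m Q)).
    by rewrite subr_eq0 eq_sym.
  rewrite mulmxDr !mulmxBl -(mulmxA P Q Q) QQ PP PQ -mulmxA PP.
  by rewrite subrr addr0 scale1r.
- move=> r /eigenvalueP[v hv v0].
  have hP : v *m Q *m P = (r - 1) *: (v *m P).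
    have := congr1 (mulmx^~ P) hv; rewrite mulmxDr mulmxDl -!scalemxAl.
    rewrite -[v *m P *m P]mulmxA PP scalerBl scale1r => <-.
    by rewrite addrC addKr.
  have hQ : v *m P *m Q = (r - 1) *: (v *m Q).
    have := congr1 (mulmx^~ Q) hv; rewrite mulmxDr mulmxDl -!scalemxAl.
    rewrite -[v *m Q *m Q]mulmxA QQ scalerBl scale1r => <-.
    by rewrite addrK.
  have [r1|r1] := eqVneq r 1; first by right; rewrite r1 lexx ler1n.
  have r10 : r - 1 != 0 by rewrite subr_eq0.
  have ePQ : v *m P = v *m Q.
    by apply: (scalerI r10); rewrite -hP -hQ -!mulmxA PQ.
  move: hQ; rewrite ePQ -mulmxA QQ -{1}[v *m Q]scale1r => /eqP.
  rewrite -subr_eq0 -scalerBl scaler_eq0 => /orP[|/eqP vQ0].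
    by move=> /eqP r2; right; apply/andP; split; lra.
  move: hv => /eqP; rewrite mulmxDr ePQ vQ0 addr0 eq_sym scaler_eq0 (negPf v0).
  by rewrite orbF => /eqP ->; left.
Qed.

(** * Incidence matrices and the preconditioner of two forests *)

Section IncidenceRestriction.
Variables (R : comNzRingType) (V : finType).
Implicit Types E F G : {set (V * V)%type}.

Lemma sum_indicator (I : finType) (G : pred I) (a : I) (h : I -> R) :
  \sum_(x | G x) (x == a)%:R * h x = (G a)%:R * h a.
Proof.
rewrite big_mkcond (bigD1 a) //= eqxx mul1r big1 ?addr0; last first.
  by move=> x /negPf ->; rewrite mul0r if_same.
by case: (G a); rewrite ?mul1r ?mul0r.
Qed.

Lemma sum_enum_indicator (I : finType) (G : {pred I}) (a : I) (h : I -> R) :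
  \sum_(x < #|G|) (enum_val x == a)%:R * h (enum_val x) = (a \in G)%:R * h a.
Proof.
by rewrite -(big_enum_val (fun x => (x == a)%:R * h x)) sum_indicator.
Qed.

Lemma incidence_mulmxE F n (X : 'M[R]_(#|V|, n)) f c :
  (incidence R F *m X) f c =
  X (enum_rank (enum_val f).1) c - X (enum_rank (enum_val f).2) c.
Proof.
rewrite mxE; under eq_bigr => v _ do
  rewrite mxE mulrBl -[X v c](congr1 (X^~ c) (enum_valK v)).
by rewrite sumrB !(@sum_enum_indicator V _ _ (fun w => X (enum_rank w) c)) !mul1r.
Qed.

Lemma edge_restriction_incidence E F : F \subset E ->
  edge_restriction R E F *m incidence R E = incidence R F.
Proof.
move=> sFE; apply/matrixP=> f v; rewrite !mxE.
under eq_bigr => e _ do rewrite !mxE eq_sym.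
rewrite (@sum_enum_indicator (V * V)%type _ _ (fun e : V * V =>
  (enum_val v == e.1)%:R - (enum_val v == e.2)%:R)).
by rewrite (fintype.subsetP sFE) ?enum_valP // mul1r.
Qed.

Lemma edge_restrictionK E F : F \subset E ->
  edge_restriction R E F *m (edge_restriction R E F)^T = 1%:M.
Proof.
move=> sFE; apply/matrixP=> f g; rewrite !mxE.
under eq_bigr => e _ do rewrite !mxE eq_sym.
rewrite (@sum_enum_indicator (V * V)%type _ _ (fun e : V * V => (enum_val g == e)%:R)).
by rewrite (fintype.subsetP sFE) ?enum_valP // mul1r (inj_eq enum_val_inj) eq_sym.
Qed.

Lemma edge_restriction_disjoint E F G : [disjoint F & G] ->
  edge_restriction R E F *m (edge_restriction R E G)^T = 0.
Proof.
move=> dFG; apply/matrixP=> f g; rewrite !mxE.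
under eq_bigr => e _ do rewrite !mxE eq_sym.
rewrite (@sum_enum_indicator (V * V)%type _ _ (fun e : V * V => (enum_val g == e)%:R)).
case: eqP => [gf|]; last by rewrite mulr0.
by have := disjointFr dFG (enum_valP f); rewrite -gf enum_valP.
Qed.

Lemma edge_restriction_split E F G : E = F :|: G -> [disjoint F & G] ->
  (edge_restriction R E F)^T *m edge_restriction R E F
  + (edge_restriction R E G)^T *m edge_restriction R E G = 1%:M.
Proof.
move=> eqE dFG; apply/matrixP=> e e'; rewrite !mxE.
under eq_bigr => f _ do rewrite !mxE.
under [X in _ + X]eq_bigr => f _ do rewrite !mxE.
rewrite !(@sum_enum_indicator (V * V)%type _ _ (fun f : V * V => (f == enum_val e')%:R)).
rewrite -mulrDl (inj_eq enum_val_inj).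
have := enum_valP e; rewrite {2}eqE inE.
case: (boolP (enum_val e \in F)) => [eF _|_ /= ->].
  by rewrite (disjointFr dFG eF) addr0 mul1r.
by rewrite add0r mul1r.
Qed.

Lemma precond_termE E F : F \subset E ->
  precond_term R E F = (edge_restriction R E F)^T
    *m (incidence R F *m (incidence R F)^T) *m edge_restriction R E F.
Proof. by move=> sFE; rewrite /precond_term edge_restriction_incidence. Qed.

End IncidenceRestriction.

(** If v B B^T = 0 then |v B|^2 = v B B^T v^T = 0. *)
Lemma gram_unitmx (R : realType) m n (B : 'M[R]_(m, n)) :
  row_free B -> B *m B^T \in unitmx.
Proof.
move=> fB; rewrite -row_free_unit; apply: inj_row_free => v hv.
suff /eqP: v *m B = 0 by rewrite mulmx_free_eq0 // => /eqP.
apply: trmx_inj; rewrite trmx0; apply: sqr_mx_eq0.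
by rewrite trmxK trmx_mul mulmxA -(mulmxA v) hv mul0mx mxE.
Qed.

Section TwoForests.
Variables (R : realType) (V : finType) (E F G : {set (V * V)%type}).
Hypotheses (eqE : E = F :|: G) (dFG : [disjoint F & G]).
Hypotheses (freeF : row_free (incidence R F)) (freeG : row_free (incidence R G)).
Let K := incidence R E.
Let T := precond_term R E F + precond_term R E G.
Let MF := incidence R F *m (incidence R F)^T.
Let MG := incidence R G *m (incidence R G)^T.
Let PF := edge_restriction R E F.
Let PG := edge_restriction R E G.

Let sFE : F \subset E. Proof. by rewrite eqE finset.subsetUl. Qed.
Let sGE : G \subset E. Proof. by rewrite eqE finset.subsetUr. Qed.

Let T_psd : psdmx T.
Proof.
rewrite /T !precond_termE //; apply: psdmxD.
  have := psdmx_gram ((incidence R F)^T *m PF).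
  by rewrite trmx_mul trmxK !mulmxA.
have := psdmx_gram ((incidence R G)^T *m PG).
by rewrite trmx_mul trmxK !mulmxA.
Qed.

Let T' := PF^T *m invmx MF *m PF + PG^T *m invmx MG *m PG.

Let T'T : T' *m T = 1%:M.
Proof.
have uF : MF \in unitmx by exact: gram_unitmx.
have uG : MG \in unitmx by exact: gram_unitmx.
have FG0 : PF *m PG^T = 0 by exact: edge_restriction_disjoint.
have GF0 : PG *m PF^T = 0.
  by apply: edge_restriction_disjoint; rewrite disjoint_sym.
rewrite /T !precond_termE // -/PF -/PG /T' -/MF -/MG.
move: uF uG; generalize MF MG => A B uA uB; rewrite !mulmxDl !mulmxDr.
rewrite -!mulmxA ![PF *m (PF^T *m _)]mulmxA ![PG *m (PG^T *m _)]mulmxA.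
rewrite ![PF *m (PG^T *m _)]mulmxA ![PG *m (PF^T *m _)]mulmxA.
rewrite FG0 GF0 !edge_restrictionK // !mul1mx !mul0mx !mulmx0 addr0 add0r.
by rewrite !mulKmx // edge_restriction_split.
Qed.

Lemma precond_unitmx : T \in unitmx.
Proof. by case: (mulmx1_unit T'T). Qed.

(** Both restrictions are coisometries with complementary ranges, so the inverse of
T acts blockwise, and each block of K^T T^(-1) K only sees one forest. *)
Lemma preconditioned_gram :
  (mxinvsqrt T *m K)^T *m (mxinvsqrt T *m K)
  = (incidence R F)^T *m invmx MF *m incidence R F
    + (incidence R G)^T *m invmx MG *m incidence R G.
Proof.
have [symS sqrS] : psdmx (mxinvsqrt T) /\ mxinvsqrt T *m mxinvsqrt T = invmx T.
  rewrite /mxinvsqrt /mxsqrt; case: xgetP => [S _ //|none].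
  have [S hS] := psdmx_sqrt (psdmx_inv precond_unitmx T_psd).
  by case: (none S).
rewrite trmx_mul symS.1 mulmxA -(mulmxA K^T) sqrS.
have -> : invmx T = T'.
  by rewrite -[RHS](mulmxK precond_unitmx) T'T mul1mx.
rewrite /T' mulmxDr mulmxDl -!(edge_restriction_incidence _ sFE).
by rewrite -!(edge_restriction_incidence _ sGE) !trmx_mul !mulmxA.
Qed.

End TwoForests.

(** * Forests of parallel chains *)

(** The vertices are arranged in parallel chains: [ch v] names the chain of v,
[pos v] is its position there, and [mk] is the inverse of (pos, ch).  The edges
join neighbours in a chain.  The two directions of the grid are the instances
that exchange the roles of the coordinates. *)
Section Chains.
Variables (R : realType) (V W : finType) (n : nat).
Variables (pos : V -> 'I_n) (ch : V -> W) (mk : 'I_n -> W -> V).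
Hypotheses (mkK : forall v, mk (pos v) (ch v) = v)
  (pos_mk : forall i w, pos (mk i w) = i) (ch_mk : forall i w, ch (mk i w) = w).
Variable F : {set (V * V)%type}.
Hypothesis hF : oriented_edge_set
  (fun a b => (ch a == ch b) && path_graph (pos a) (pos b)) F.

Definition chain_average : 'M[R]_#|V| :=
  \matrix_(v, w) ((ch (enum_val w) == ch (enum_val v))%:R / n%:R).

Lemma chain_edge e : e \in F ->
  ch e.1 = ch e.2 /\ path_graph (pos e.1) (pos e.2).
Proof.
by case: e => a b abF; have [] := hF a b; rewrite abF => /andP[/eqP].
Qed.

Lemma coord_inj x y : ch x = ch y -> pos x = pos y :> nat -> x = y.
Proof. by move=> c /val_inj p; rewrite -[x]mkK -[y]mkK c p. Qed.

(** Let u be the indicator of the part of a chain on one side of an edge f.  Then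
K_F u is supported at f, so v K_F = 0 makes the coefficient of v at f vanish. *)
Lemma chain_forest_row_free : row_free (incidence R F).
Proof.
apply: inj_row_free => v hv; apply/rowP=> f; rewrite mxE.
set e := enum_val f; have eF : e \in F by exact: enum_valP.
have [che pe] := chain_edge eF.
pose cut x := (ch x == ch e.1) && (pos x <= minn (pos e.1) (pos e.2))%N.
pose u : 'cV[R]_#|V| := \col_x (cut (enum_val x))%:R.
have hu g : (incidence R F *m u) g 0 =
    (cut (enum_val g).1)%:R - (cut (enum_val g).2)%:R.
  by rewrite incidence_mulmxE !mxE !enum_rankK.
have hu0 g : g != f -> (incidence R F *m u) g 0 = 0.
  rewrite hu => gf; apply/eqP; rewrite subr_eq0; apply/eqP; congr (_%:R).
  have e'F := enum_valP g; set e' := enum_val g in e'F *.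
  have [che' pe'] := chain_edge e'F.
  rewrite /cut -che'; case: eqP => //= cc.
  apply/eqP; apply: contraNT gf => ne; apply/eqP/enum_val_inj; rewrite -/e -/e'.
  have chb : ch e'.2 = ch e.2 by rewrite -che' cc.
  (* Only one step of the chain crosses the cut, so the two edges agree up to
     orientation. *)
  have [[p1 p2]|[p1 p2]] :
      (pos e'.1 = pos e.1 :> nat /\ pos e'.2 = pos e.2 :> nat) \/
      (pos e'.1 = pos e.2 :> nat /\ pos e'.2 = pos e.1 :> nat).
  - move: ne pe pe'; rewrite /path_graph.
    by case: leqP => h1; case: leqP => h2 // _ /orP[]/eqP ? /orP[]/eqP ?; lia.
  - rewrite [e']surjective_pairing [e in RHS]surjective_pairing.
    by rewrite (coord_inj cc p1) (coord_inj chb p2).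
  (* The reversed edge is excluded by the orientation. *)
  - have [_ /negP []] := hF e.1 e.2; rewrite -surjective_pairing eF /=.
    rewrite -(coord_inj (etrans cc che) p1).
    by rewrite -(coord_inj (etrans chb (esym che)) p2) -surjective_pairing.
have hf : (incidence R F *m u) f 0 != 0.
  rewrite hu -/e /cut -che eqxx /=; move: pe; rewrite /path_graph.
  case/orP=> /eqP <-.
    by rewrite (minn_idPl (leqnSn _)) leqnn ltnn subr0 oner_neq0.
  by rewrite (minn_idPr (leqnSn _)) leqnn ltnn sub0r oppr_eq0 oner_neq0.
have : (v *m incidence R F *m u) 0 0 = v 0 f * (incidence R F *m u) f 0.
  by rewrite -mulmxA mxE (bigD1 f) //= big1 ?addr0 // => g /hu0 ->; rewrite mulr0.
rewrite hv mul0mx mxE => /esym/eqP; rewrite mulf_eq0 (negPf hf) orbF.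
by move/eqP.
Qed.

Lemma chain_average_sym : chain_average^T = chain_average.
Proof. by apply/matrixP=> v w; rewrite !mxE eq_sym. Qed.

Lemma incidence_chain_average : incidence R F *m chain_average = 0.
Proof.
apply/matrixP=> f w; rewrite incidence_mulmxE !mxE !enum_rankK.
by have [-> _] := chain_edge (enum_valP f); rewrite subrr.
Qed.

Lemma chain_averageE m (X : 'M[R]_(#|V|, m)) v c : (chain_average *m X) v c =
  (\sum_(i < n) X (enum_rank (mk i (ch (enum_val v)))) c) / n%:R.
Proof.
rewrite mxE mulr_suml.
under eq_bigr => x _ do rewrite mxE -{2}[x]enum_valK.
rewrite -(@big_enum_val _ _ _ V V (fun x =>
  (ch x == ch (enum_val v))%:R / n%:R * X (enum_rank x) c)) /=.
rewrite (bigID (fun x => ch x == ch (enum_val v))) /=.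
rewrite [X in _ + X]big1 ?addr0; last by move=> x /negPf ->; rewrite !mul0r.
rewrite (reindex_onto (fun i => mk i (ch (enum_val v))) pos); last first.
  by move=> x /eqP <-; rewrite mkK.
apply: eq_big => [i|i _]; first by rewrite ch_mk pos_mk !eqxx.
by rewrite ch_mk eqxx mul1r mulrC.
Qed.

(** A function killed by K_F takes equal values at neighbours, hence is constant
along each chain. *)
Lemma incidence_kernel_average m (X : 'M[R]_(#|V|, m)) :
  incidence R F *m X = 0 -> chain_average *m X = X.
Proof.
move=> hX; pose x v c := X (enum_rank v) c.
have step a b c : (a, b) \in F -> x a c = x b c.
  move=> abF; pose f := enum_rank_in abF (a, b).
  have := congr1 (fun Y : 'M[R]_(#|F|, m) => Y f c) hX.
  rewrite /= incidence_mulmxE enum_rankK_in // mxE => /eqP.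
  by rewrite subr_eq0 => /eqP.
have const w c k (i j : 'I_n) : i = k :> nat -> j = 0 :> nat ->
    x (mk i w) c = x (mk j w) c.
  elim: k i => [|k IH] i ik j0.
    by congr (x (mk _ w) c); apply: val_inj; rewrite /= ik j0.
  have kn : (k < n)%N by apply: leq_trans (ltn_ord i); rewrite ik.
  rewrite -(IH (Ordinal kn)) //.
  have [/esym] := hF (mk i w) (mk (Ordinal kn) w).
  rewrite !ch_mk !pos_mk eqxx /path_graph /= -ik eqxx orbT.
  by case/orP=> [/step|/step/esym] ->.
apply/matrixP=> v c; rewrite chain_averageE.
set a := enum_val v; have n0 : (0 < n)%N by case: (pos a) => i; apply: leq_trans.
pose j := Ordinal n0.
under eq_bigr => i _ do rewrite -/(x _ _) (const _ _ i i j) //.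
rewrite sumr_const card_ord -[X in X / _]mulr_natr mulfK; last by rewrite pnatr_eq0 -lt0n.
by rewrite -(const _ _ (pos a) (pos a)) // mkK /x enum_valK.
Qed.

(** Let Q be the left-hand side.  Since K_F Q = K_F, the columns of 1 - Q are
constant on chains and fixed by averaging; since K_F kills the average and both
matrices are symmetric, the average kills Q.  So 1 - Q = avg (1 - Q) = avg. *)
Lemma chain_projectionE (A := incidence R F) :
  A^T *m invmx (A *m A^T) *m A = 1%:M - chain_average.
Proof.
have uM : A *m A^T \in unitmx by apply/gram_unitmx/chain_forest_row_free.
set Q := _ *m A.
have symQ : Q^T = Q.
  rewrite /Q !trmx_mul trmxK trmx_inv trmx_mul trmxK mulmxA //.
have AQ : chain_average *m Q = 0.
  apply: trmx_inj; rewrite trmx_mul symQ chain_average_sym trmx0.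
  by rewrite /Q -(mulmxA _ A) incidence_chain_average mulmx0.
have := @incidence_kernel_average _ (1%:M - Q).
rewrite mulmxBr mulmx1 /Q !mulmxA mulmxV // mul1mx subrr => /(_ erefl).
rewrite -/Q mulmxBr mulmx1 AQ subr0 => ->.
by rewrite opprB addrC subrK.
Qed.

Lemma chain_average_idem : chain_average *m chain_average = chain_average.
Proof. exact/incidence_kernel_average/incidence_chain_average. Qed.

End Chains.

(** * The preconditioned grid *)

Section Grid.
Variables (R : realType) (n1 n2 : nat).
Variable E : {set (('I_n1 * 'I_n2) * ('I_n1 * 'I_n2))%type}.
Hypothesis hE : oriented_edge_set (@grid n1 n2) E.

Lemma path_graph_irr n (i : 'I_n) : path_graph i i = false.
Proof. by rewrite /path_graph gtn_eqF // . Qed.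

Lemma edges1_chains : oriented_edge_set
  (fun a b : 'I_n1 * 'I_n2 => (a.2 == b.2) && path_graph a.1 b.1) (edges1 E).
Proof.
move=> a b; have [gE nE] := hE a b; rewrite !inE /= (eq_sym b.2).
case: eqP => [e|_]; rewrite ?andbT ?andbF //; split=> //; rewrite -gE.
by rewrite /grid /cartesian_product e eqxx path_graph_irr andbF.
Qed.

Lemma edges2_chains : oriented_edge_set
  (fun a b : 'I_n1 * 'I_n2 => (a.1 == b.1) && path_graph a.2 b.2) (edges2 E).
Proof.
move=> a b; have [gE nE] := hE a b; rewrite !inE /= (eq_sym b.1).
case: eqP => [e|_]; rewrite ?andbT ?andbF //; split=> //; rewrite -gE.
by rewrite /grid /cartesian_product e eqxx path_graph_irr andbF orbF.
Qed.

Lemma edges_split : E = edges1 E :|: edges2 E.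
Proof.
apply/setP=> -[a b]; rewrite !inE /=; case abE: (_ \in E) => //=.
have [gE _] := hE a b; move: gE; rewrite abE /= /grid /cartesian_product.
by case: eqP; case: eqP; rewrite ?orbT ?andbF.
Qed.

Lemma edges_disjoint : [disjoint edges1 E & edges2 E].
Proof.
rewrite finset.disjoints_subset; apply/fintype.subsetP=> -[a b]; rewrite !inE /=.
case abE: (_ \in E) => //= /eqP e2; apply/eqP=> e1.
have [gE _] := hE a b; move: gE.
by rewrite abE /grid /cartesian_product e1 e2 !path_graph_irr !andbF.
Qed.

Let A1 := @chain_average R _ _ n1 (snd : 'I_n1 * 'I_n2 -> 'I_n2).
Let A2 := @chain_average R _ _ n2 (fst : 'I_n1 * 'I_n2 -> 'I_n1).
Let mk2 (j : 'I_n2) (i : 'I_n1) := (i, j).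

Lemma preconditioned_gramE (M := mxinvsqrt (grid_precond R E) *m incidence R E) :
  M^T *m M = (1%:M - A1) + (1%:M - A2).
Proof.
have mk1K (v : 'I_n1 * 'I_n2) : (v.1, v.2) = v by case: v.
rewrite /M preconditioned_gram; first last.
- exact: (@chain_forest_row_free _ _ _ _ _ _ mk2 mk1K _ edges2_chains).
- exact: (@chain_forest_row_free _ _ _ _ _ _ pair mk1K _ edges1_chains).
- exact: edges_disjoint.
- exact: edges_split.
rewrite (@chain_projectionE _ _ _ _ _ _ pair mk1K _ _ _ edges1_chains) //.
by rewrite (@chain_projectionE _ _ _ _ _ _ mk2 mk1K _ _ _ edges2_chains).
Qed.

(** A row and a column of the grid meet in exactly one vertex, so the composite is
the average over the whole grid.  This matrix is symmetric, which is why the two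
averages commute. *)
Lemma average_comp v w : (A1 *m A2) v w = (n1 * n2)%:R^-1.
Proof.
rewrite (@chain_averageE _ _ _ _ fst snd pair) //; last by case.
under eq_bigr => i _ do rewrite mxE enum_rankK /=.
rewrite -mulr_suml (bigD1 (enum_val w).1) //= eqxx big1 => [|i]; last first.
  by rewrite eq_sym => /negPf ->.
by rewrite addr0 mul1r natrM invfM mulrC.
Qed.

Hypotheses (gt1n1 : (1 < n1)%N) (gt1n2 : (1 < n2)%N).

Lemma condition_number_preconditioned :
  condition_number (mxinvsqrt (grid_precond R E) *m incidence R E) = Num.sqrt 2.
Proof.
have mk1K (v : 'I_n1 * 'I_n2) : (v.1, v.2) = v by case: v.
have A12 : A1 *m A2 = A2 *m A1.
  have -> : A2 *m A1 = (A1 *m A2)^T by rewrite trmx_mul !chain_average_sym.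
  by apply/matrixP=> v w; rewrite [RHS]mxE !average_comp.
have idem1 : A1 *m A1 = A1.
  exact: (@chain_average_idem _ _ _ _ _ _ pair mk1K _ _ _ edges1_chains).
have idem2 : A2 *m A2 = A2.
  exact: (@chain_average_idem _ _ _ _ _ _ mk2 mk1K _ _ _ edges2_chains).
have complK m (A : 'M[R]_m) : A *m A = A -> (1%:M - A) *m (1%:M - A) = 1%:M - A.
  by move=> AA; rewrite mulmxBr mulmx1 mulmxBl mul1mx AA subrr subr0.
have i0 : 'I_n1 by exists 0%N; apply: ltn_trans gt1n1.
have j0 : 'I_n2 by exists 0%N; apply: ltn_trans gt1n2.
pose v := enum_rank (i0, j0).
have p2 : n2%:R != 0 :> R by rewrite pnatr_eq0 -lt0n (ltn_trans _ gt1n2).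
have invn1 (k : nat) : (1 < k)%N -> 1 - k%:R^-1 != 0 :> R.
  by move=> k1; rewrite subr_eq0 eq_sym invr_eq1 pnatr_eq1 gtn_eqF.
have [q1 q2] := (invn1 _ gt1n1, invn1 _ gt1n2).
have prod : (1%:M - A1) *m (1%:M - A2) = 1%:M - A1 - A2 + A1 *m A2.
  rewrite mulmxBr mulmx1 mulmxBl mul1mx opprB [A1 *m A2 - _]addrC addrA //.
apply: condition_number_commuting_projections preconditioned_gramE _ _ _ _ _.
- exact: complK.
- exact: complK.
- by rewrite prod mulmxBr mulmx1 mulmxBl mul1mx -A12 opprB [A1 *m A2 - _]addrC
    addrA [1%:M - _ - _]addrAC.
(* Neither product degenerates: compare one diagonal entry. *)
- rewrite prod; apply/eqP=> /(congr1 (fun X : 'M[R]_#|_| => X v v)).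
  move/eqP; apply/negP; rewrite mxE average_comp !mxE !eqxx !mulr1n !mul1r.
  rewrite (_ : _ + _ = (1 - n1%:R^-1) * (1 - n2%:R^-1)).
    by rewrite mulf_neq0 ?q1 ?q2.
  by rewrite natrM invfM; ring.
- rewrite prod; apply/eqP=> /(congr1 (fun X : 'M[R]_#|_| => X v v)).
  move/eqP; apply/negP; rewrite mxE average_comp !mxE !eqxx !mulr1n !mul1r -subr_eq0.
  rewrite (_ : _ - _ = - (1 - n1%:R^-1) * n2%:R^-1).
    by rewrite mulf_neq0 ?oppr_eq0 ?q1 ?invr_eq0.
  by rewrite natrM invfM; ring.
Qed.

End Grid.

(** * Eigenvalues of the path *)

Section SineBound.
Import numFieldNormedType.Exports.

(** Mean value theorem, with |cos| <= 1. *)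
Lemma abs_sin_le (R : realType) (x : R) : `|sin x| <= `|x|.
Proof.
wlog x0 : x / 0 < x.
  move=> h; have [/h//|x0] := ltP 0 x; move: x0.
  rewrite le_eqVlt => /predU1P[->|x0]; first by rewrite sin0.
  by rewrite -normrN -sinN -[X in _ <= X]normrN h // oppr_gt0.
have dsin y : y \in `]0, x[ -> is_derive y 1 (@sin R) (cos y).
  by move=> _; exact: is_derive_sin.
have csin : {within `[0, x], continuous (@sin R)}%classic.
  exact/continuous_subspaceT/continuous_sin.
have [c _] := MVT x0 dsin csin.
rewrite sin0 !subr0 => ->.
by rewrite normrM ler_piMl // cos_max.
Qed.

End SineBound.

Definition path_eigenvalue (R : realType) (n k : nat) : R :=
  2 - 2 * cos (k%:R * pi / n%:R).

(** 2 - 2 cos x = 4 sin(x / 2)^2. *)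
Lemma path_eigenvalue_le (R : realType) n :
  path_eigenvalue R n 1 <= (pi / n%:R) ^+ 2.
Proof.
rewrite /path_eigenvalue mul1r; set x := pi / n%:R.
have x0 : 0 <= x by rewrite divr_ge0 ?pi_ge0.
have -> : x = (x / 2) *+ 2 by rewrite -mulr_natr divfK.
rewrite cos_mulr2n cos2sin2.
have : sin (x / 2) ^+ 2 <= (x / 2) ^+ 2.
  by rewrite -[leLHS]real_normK ?num_real // -[leRHS]real_normK ?num_real //
    lerXn2r ?nnegrE ?normr_ge0 // abs_sin_le.
nra.
Qed.

Lemma path_eigenvalue_gt0 (R : realType) n : (0 < n)%N ->
  0 < path_eigenvalue R n 1.
Proof.
move=> n0; rewrite /path_eigenvalue mul1r subr_gt0.
rewrite gtr_pMr //.
have p0 : 0 < pi / n%:R :> R by rewrite divr_gt0 ?pi_gt0 ?ltr0n.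
rewrite -{2}cos0 ltr_cos // in_itv /= ?lexx ?pi_ge0 // ltW //=.
by rewrite ler_pdivrMr ?ltr0n // ler_peMr ?pi_ge0 // ler1n.
Qed.

(** * The Laplacian spectrum of the grid *)

(** An edge contributes the same term to its endpoint a for either orientation, and
exactly one orientation is present. *)
Lemma laplacianE (R : comNzRingType) (V : finType) (g : rel V)
    (E : {set (V * V)%type}) (u : V -> R) v : oriented_edge_set g E ->
  ((incidence R E)^T *m (incidence R E *m \col_x u (enum_val x))) v 0 =
  \sum_w (g (enum_val v) w)%:R * (u (enum_val v) - u w).
Proof.
move=> hE; set a := enum_val v; rewrite mxE.
under eq_bigr => e _ do
  rewrite incidence_mulmxE !mxE !enum_rankK -/a (eq_sym a) (eq_sym a).
rewrite -(@big_enum_val _ _ _ _ (mem E) (fun p : V * V =>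
  ((p.1 == a)%:R - (p.2 == a)%:R) * (u p.1 - u p.2))) big_mkcond /=.
transitivity (\sum_(x : V) \sum_(y : V) ((x == a)%:R * (((x, y) \in E)%:R * (u x - u y))
    - (y == a)%:R * (((x, y) \in E)%:R * (u x - u y)))).
  rewrite pair_bigA /=; apply: eq_bigr => -[x y] _ /=.
  by case: (_ \in E); rewrite ?mul1r ?mul0r ?mulr0 ?subrr // mulrBl.
under [LHS]eq_bigr => x _ do rewrite sumrB -mulr_sumr.
rewrite sumrB sum_indicator mul1r exchange_big /=.
under [X in _ - X]eq_bigr => y _ do rewrite -mulr_sumr.
rewrite sum_indicator mul1r -sumrB; apply: eq_bigr => w _.
have [-> ] := hE a w.
case: (_ \in E); case: (_ \in E); rewrite // => _; rewrite ?mul1r ?mul0r; ring.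
Qed.

(** At an end of the path the missing neighbour is replaced by the end itself: at the
right this is the reflection condition on f, at the left it is the convention
0.-1 = 0. *)
Lemma path_graph_sum (R : comNzRingType) n (f : nat -> R) (i : 'I_n) :
  f n = f n.-1 ->
  \sum_(j < n) (path_graph i j)%:R * (f i - f j)
  = (f i - f i.+1) + (f i - f i.-1).
Proof.
move=> fn.
transitivity (\sum_(j < n) ((i.+1 == j :> nat)%:R * (f i - f j) +
   (j.+1 == i :> nat)%:R * (f i - f j))).
  apply: eq_bigr => j _; rewrite /path_graph -mulrDl -natrD; congr (_%:R * _).
  by case: eqP; case: eqP => //; lia.
rewrite big_split /=; congr (_ + _).
  have [lt|ge] := ltnP i.+1 n.
    have eqj (j : 'I_n) : (i.+1 == j :> nat) = (j == Ordinal lt) by rewrite eq_sym.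
    under eq_bigr => j _ do rewrite eqj.
    by rewrite sum_indicator mul1r.
  have ein : n = i.+1 by apply/eqP; rewrite eqn_leq ge ltn_ord.
  have -> : f i.+1 = f i by rewrite -ein fn; congr f; rewrite [in LHS]ein.
  by rewrite subrr big1 // => j _; rewrite gtn_eqF ?mul0r // -ein.
case: (posnP i) => [i0|ip].
  by rewrite i0 subrr big1 // => j _; rewrite mul0r.
have lt : (i.-1 < n)%N by rewrite (leq_ltn_trans (leq_pred _)).
have eqj (j : 'I_n) : (j.+1 == i :> nat) = (j == Ordinal lt).
  by rewrite -[in LHS](prednK ip).
under eq_bigr => j _ do rewrite eqj.
by rewrite sum_indicator mul1r.
Qed.

(** The sampling points m + 1/2 make the mode even about both ends of the path. *)
Definition path_mode (R : realType) (n k m : nat) : R :=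
  cos (k%:R * pi / n%:R * (m%:R + 2^-1)).

Lemma sin_nat_pi (R : realType) k : sin (k%:R * pi) = 0 :> R.
Proof.
by rewrite mulrC mulr_natr -[_ *+ _]add0r (alternatingn (@sinDpi R)) sin0 mulr0.
Qed.

Lemma path_mode_reflect (R : realType) n k : (0 < n)%N ->
  path_mode R n k n = path_mode R n k n.-1.
Proof.
move=> n0; rewrite /path_mode; set t := _ / _.
have nz : n%:R != 0 :> R by rewrite pnatr_eq0 -lt0n.
have e : t * n%:R = k%:R * pi by rewrite divfK.
(* The two arguments are symmetric about k pi. *)
have -> : t * (n%:R + 2^-1) = k%:R * pi + t / 2 by rewrite mulrDr e.
have -> : t * (n.-1%:R + 2^-1) = k%:R * pi - t / 2.
  by rewrite -e -{2}(prednK n0) -natr1; field.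
by rewrite cosD cosB sin_nat_pi !mul0r subr0 addr0.
Qed.

(** Away from the ends this is cos(x - t) + cos(x + t) = 2 cos t cos x; the two
reflections make it hold at the ends. *)
Lemma path_modeE (R : realType) n k (i : 'I_n) :
  \sum_(j < n) (path_graph i j)%:R * (path_mode R n k i - path_mode R n k j)
  = path_eigenvalue R n k * path_mode R n k i.
Proof.
rewrite path_graph_sum; last by rewrite path_mode_reflect // (leq_trans _ (ltn_ord i)).
rewrite /path_eigenvalue /path_mode; set t := _ / _.
(* At i = 0 the two arguments are t / 2 and - t / 2. *)
have -> : cos (t * (i.-1%:R + 2^-1)) = cos (t * (i%:R + 2^-1) - t).
  case: (nat_of_ord i) => [|m] /=.
    by rewrite -[RHS]cosN; congr cos; field.
  by rewrite -natr1; congr cos; field.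
have -> : t * (i.+1%:R + 2^-1) = t * (i%:R + 2^-1) + t by rewrite -natr1; field.
by rewrite cosB cosD; ring.
Qed.

(** This value certifies that the mode is not the zero vector. *)
Lemma path_mode0_gt0 (R : realType) n k : (k < n)%N -> 0 < path_mode R n k 0.
Proof.
move=> kn; rewrite /path_mode add0r; apply: cos_gt0_pihalf.
have n0 : 0 < n%:R :> R by rewrite ltr0n (leq_ltn_trans _ kn).
set t : R := _ * pi / _.
have t0 : 0 <= t by rewrite divr_ge0 ?mulr_ge0 ?pi_ge0.
have tpi : t < pi.
  by rewrite ltr_pdivrMr // mulrC ltr_pM2l ?pi_gt0 // ltr_nat.
have := pi_gt0 R; lra.
Qed.

(** A step in the grid moves one coordinate, so the Laplacian acts on a product of
modes through each factor separately and the two eigenvalues add. *)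
Lemma grid_eigenvalue (R : realType) n1 n2
    (E : {set (('I_n1 * 'I_n2) * ('I_n1 * 'I_n2))%type}) k1 k2 :
  oriented_edge_set (@grid n1 n2) E -> (k1 < n1)%N -> (k2 < n2)%N ->
  eigenvalue ((incidence R E)^T *m incidence R E)
    (path_eigenvalue R n1 k1 + path_eigenvalue R n2 k2).
Proof.
move=> hE lt1 lt2.
pose f := path_mode R n1 k1; pose g := path_mode R n2 k2.
pose u (v : 'I_n1 * 'I_n2) := f v.1 * g v.2.
pose U : 'cV[R]_#|{: 'I_n1 * 'I_n2}| := \col_x u (enum_val x).
apply: (@eigenvalue_left_mul _ _ _ _ U^T).
  pose o := (Ordinal (leq_ltn_trans (leq0n _) lt1),
             Ordinal (leq_ltn_trans (leq0n _) lt2)).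
  apply/eqP=> /(congr1 (fun X : 'M[R]_(1, _) => X 0 (enum_rank o))).
  apply/eqP; rewrite !mxE enum_rankK /u /= gt_eqF //.
  by rewrite mulr_gt0 ?path_mode0_gt0.
apply: trmx_inj; rewrite !trmx_mul !trmxK -mulmxA linearZ /= trmxK.
apply/colP=> v; rewrite (laplacianE _ _ hE) !mxE.
case: (enum_val v) => i j; rewrite /u /=.
transitivity (\sum_i' \sum_j'
  ((i' == i)%:R * ((path_graph j j')%:R * (f i * g j - f i' * g j')) +
   (j' == j)%:R * ((path_graph i i')%:R * (f i * g j - f i' * g j')))).
  rewrite pair_bigA /=; apply: eq_bigr => -[i' j'] _ /=.
  rewrite /grid /cartesian_product /= !(eq_sym i) !(eq_sym j).
  case: eqP => [->|_]; case: eqP => [->|_] /=;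
    by rewrite ?path_graph_irr ?orbF ?mulr0n ?(mul0r, mulr0) ?mul1r ?addr0 ?add0r.
under eq_bigr => i' _ do rewrite big_split /= -mulr_sumr sum_indicator mul1r.
rewrite big_split /= sum_indicator mul1r.
under eq_bigr => j' _ do rewrite -mulrBr mulrCA.
under [X in _ + X]eq_bigr => i' _ do rewrite -mulrBl mulrA.
rewrite -mulr_sumr -mulr_suml !path_modeE -/f -/g; ring.
Qed.

Lemma path_eigenvalue0 (R : realType) n : path_eigenvalue R n 0 = 0.
Proof. by rewrite /path_eigenvalue !mul0r cos0 mulr1 subrr. Qed.

Lemma path_eigenvalue_last (R : realType) n : (1 < n)%N ->
  2 <= path_eigenvalue R n n.-1.
Proof.
move=> n1; rewrite /path_eigenvalue.
have n0 : 0 < n%:R :> R by rewrite ltr0n (ltn_trans _ n1).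
have -> : n.-1%:R * pi / n%:R = pi - pi / n%:R :> R.
  rewrite -subn1 natrB ?(ltnW n1) //; field; exact: lt0r_neq0.
rewrite cosB cospi sinpi.
suff : 0 <= cos (pi / n%:R) :> R by lra.
apply: cos_ge0_pihalf; have := pi_gt0 R => p0.
have -> : pi / n%:R <= pi / 2 :> R.
  by rewrite ler_wpM2l ?pi_ge0 // lef_pV2 ?posrE // ler_nat.
rewrite andbT; apply: (@le_trans _ _ 0); first by lra.
by rewrite divr_ge0 ?pi_ge0.
Qed.

(** The highest mode in both directions is compared with the lowest nonconstant
mode, which lives along the longer side. *)
Lemma condition_number_grid_ge (R : realType) (n1 n2 : nat)
    (E : {set (('I_n1 * 'I_n2) * ('I_n1 * 'I_n2))%type}) :
  (1 < n1)%N -> (1 < n2)%N -> oriented_edge_set (@grid n1 n2) E ->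
  2 * (maxn n1 n2)%:R / pi <= condition_number (incidence R E).
Proof.
move=> lt1 lt2 hE.
have pos1 : (0 < n1)%N by exact: ltnW.
have pos2 : (0 < n2)%N by exact: ltnW.
have ltp n : (0 < n)%N -> (n.-1 < n)%N by move=> n0; rewrite prednK.
have top := grid_eigenvalue R hE (ltp _ pos1) (ltp _ pos2).
set N := maxn n1 n2.
have lo : eigenvalue ((incidence R E)^T *m incidence R E) (path_eigenvalue R N 1).
  rewrite /N; case: leqP => _.
    by have := grid_eigenvalue R hE pos1 lt2; rewrite path_eigenvalue0 add0r.
  by have := grid_eigenvalue R hE lt1 pos2; rewrite path_eigenvalue0 addr0.
have N0 : (0 < N)%N by rewrite leq_max pos1.
have lam0 := path_eigenvalue_gt0 R N0.
apply: le_trans (condition_number_ge top lo lam0).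
have N0R : 0 < N%:R :> R by rewrite ltr0n.
rewrite -mulrA -invf_div; apply: ler_pM => //; first by rewrite invr_ge0 divr_ge0 ?pi_ge0.
  rewrite -[leLHS]ger0_norm // -sqrtr_sqr ler_wsqrtr //.
  have := path_eigenvalue_last R lt1; have := path_eigenvalue_last R lt2; lra.
rewrite lef_pV2 ?posrE ?sqrtr_gt0 ?divr_gt0 ?pi_gt0 //.
rewrite -[leRHS]ger0_norm ?divr_ge0 ?pi_ge0 // -sqrtr_sqr ler_wsqrtr //.
exact: path_eigenvalue_le.
Qed.

Theorem theorem4 (R : realType) (n1 n2 : nat)
  (hn1 : (3 <= n1)%N) (hn2 : (3 <= n2)%N)
  (E : {set (('I_n1 * 'I_n2) * ('I_n1 * 'I_n2))%type})
  (hE : oriented_edge_set (@grid n1 n2) E) :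
  condition_number (incidence R E)
    >= Num.sqrt 2 * (maxn n1 n2)%:R / Num.sqrt (pi ^+ 2 / 2)
  /\ condition_number (mxinvsqrt (grid_precond R E) *m incidence R E)
     = Num.sqrt 2.
Proof.
have [lt1 lt2] : (1 < n1)%N /\ (1 < n2)%N by split; apply: ltnW.
split; last exact: condition_number_preconditioned.
apply: le_trans (condition_number_grid_ge R lt1 lt2 hE).
rewrite sqrtrM ?sqr_ge0 // sqrtr_sqr ger0_norm ?pi_ge0 // sqrtrV //.
rewrite le_eqVlt; apply/orP; left; apply/eqP.
have s2 : Num.sqrt 2 * Num.sqrt 2 = 2 :> R by rewrite -expr2 sqr_sqrtr.
by rewrite -[in RHS]s2 invf_div; ring.
Qed.
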